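(* Let $S$ and $S'$ be localisable semigroups. A map $\phi\colon S\to S'$ is a morphism of localisable semigroups if and only if it is a functor of transcription categories $\mathscr{C}(S)\to\mathscr{C}(S')$.
   Context: A localisable semigroup is an algebra $(S,\cdot,+,-)$ of signature $(2,1,1)$ such that $(S,\cdot)$ is a semigroup and for all $x,y\in S$: (a) $x^{+}x=x$; (b) $(xy)^{+}=(xy^{+})^{+}$; (c) $x^{+}y^{+}=(x^{+}y)^{+}$; (d) $xx^{-}=x$; (e) $(xy)^{-}=(x^{-}y)^{-}$; (f) $x^{-}y^{-}=(xy^{-})^{-}$; (g) $(x^{+})^{-}=x^{+}$ and $(x^{-})^{+}=x^{-}$. We write $S^{+}=\{x^{+}:x\in S\}=\{x^{-}:x\in S\}$. Maps are written on the right. A morphism of localisable semigroups $\phi\colon S\to S'$ is a semigroup morphism such that $(x\phi)^{+}=(x^{+})\phi$ and $(x\phi)^{-}=(x^{-})\phi$ for all $x\in S$. For a localisable semigroup $S$, $\mathscr{C}(S)=(S,\circ,+,-)$ is the small category with underlying set of arrows $S$, in which the trace product $x\circ y$ is defined exactly when $x^{-}=y^{+}$ and then $x\circ y=x\cdot y$ (so $x^{+}$ and $x^{-}$ are the identities with $x^+\circ x = x = x\circ x^-$, and the set of identities is $S^{+}$). It carries the transcription maps ${}_{e}|x=e\cdot x$ and $x|_{f}=x\cdot f$ for $x\in S$, $e,f\in S^{+}$. With these it is what is called a transcription category. A functor (morphism) of transcription categories $\psi\colon C\to C'$ is a map that is a functor in the usual sense, i.e. $(x\psi)^{+}=(x^{+})\psi$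 and $(x\psi)^{-}=(x^{-})\psi$ for all $x$, and $(x\circ y)\psi=(x\psi)\circ(y\psi)$ whenever $x\circ y$ is defined, and that preserves the transcription maps: $(x|_{e})\psi=(x\psi)|_{e\psi}$ and $({}_{e}|x)\psi={}_{e\psi}|(x\psi)$ for all arrows $x$ and identities $e$. *)

(* Defs.v *)
(* MathComp *)
From HB Require Import structures.
From mathcomp Require Import ssreflect ssrfun ssrbool monoid.

Set Implicit Arguments.
Unset Strict Implicit.
Unset Printing Implicit Defensive.

Local Open Scope group_scope.

Reserved Notation "x ^{+}" (at level 1, left associativity, format "x ^{+}").
Reserved Notation "x ^{-}" (at level 1, left associativity, format "x ^{-}").

(* Built on magmaType because the library's semigroupType also demands a
   choiceType structure on the carrier, which is not wanted here. *)
HB.mixin Record Magma_isLocalisable S of Magma S := {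
  splus : S -> S;
  sminus : S -> S;
  smulA : associative (@mul S);
  splus_mul : forall x : S, splus x * x = x;
  splusMr : forall x y : S, splus (x * y) = splus (x * splus y);
  splusMl : forall x y : S, splus x * splus y = splus (splus x * y);
  smul_minus : forall x : S, x * sminus x = x;
  sminusMl : forall x y : S, sminus (x * y) = sminus (sminus x * y);
  sminusMr : forall x y : S, sminus x * sminus y = sminus (x * sminus y);
  sminus_plus : forall x : S, sminus (splus x) = splus x;
  splus_minus : forall x : S, splus (sminus x) = sminus x
}.

#[short(type="localisableType")]
HB.structure Definition Localisable := {S of Magma_isLocalisable S & Magma S}.

Notation "x ^{+}" := (splus x) : group_scope.
Notation "x ^{-}" := (sminus x) : group_scope.

Definition localisable_morphism (S S' : localisableType) (phi : S -> S') :=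
  [/\ {morph phi : x y / x * y},
      forall x, (phi x)^{+} = phi (x^{+}) &
      forall x, (phi x)^{-} = phi (x^{-})].

(* Small categories in arrows-only form, with composition in diagrammatic order
   (maps are written on the right): [comp x y h] is x followed by y, defined
   exactly when h : tgt x = src y. Objects are identified with identity arrows.
   Each transcription map takes a proof that its index is an identity, as it is
   defined for identities only: [lres e _ x] is e|x and [rres e _ x] is x|e.
   The laws that relate the transcription maps to composition in a transcription
   category play no part in the notion of functor and are left out, so every
   transcription category is an instance of this structure. *)
Record preTranscriptionCat := PreTranscriptionCat {
  arrow :> Type;
  src : arrow -> arrow;
  tgt : arrow -> arrow;
  comp : forall x y : arrow, tgt x = src y -> arrow;
  lres : forall e : arrow, (exists x, e = src x) -> arrow -> arrow;
  rres : forall e : arrow, (exists x, e = src x) -> arrow -> arrow;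
  src_src : forall x, src (src x) = src x;
  tgt_src : forall x, tgt (src x) = src x;
  src_tgt : forall x, src (tgt x) = tgt x;
  tgt_tgt : forall x, tgt (tgt x) = tgt x;
  src_comp : forall x y (h : tgt x = src y), src (comp h) = src x;
  tgt_comp : forall x y (h : tgt x = src y), tgt (comp h) = tgt y;
  comp_src : forall x (h : tgt (src x) = src x), comp h = x;
  comp_tgt : forall x (h : tgt x = src (tgt x)), comp h = x;
  compA : forall x y z (hxy : tgt x = src y) (hyz : tgt y = src z)
    (hx_yz : tgt x = src (comp hyz)) (hxy_z : tgt (comp hxy) = src z),
    comp hx_yz = comp hxy_z
}.

Arguments comp {p} x y h.
Arguments lres {p} e he x.
Arguments rres {p} e he x.

Definition is_identity (C : preTranscriptionCat) (e : C) := exists x : C, e = src x.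

(* An equation between partial expressions asserts that its right-hand side is
   defined, hence the existential quantification over proofs. *)
Record transcription_functor (C C' : preTranscriptionCat) (psi : C -> C') : Prop :=
  TranscriptionFunctor {
    functor_src : forall x, src (psi x) = psi (src x);
    functor_tgt : forall x, tgt (psi x) = psi (tgt x);
    functor_comp : forall x y (h : tgt x = src y),
      exists h' : tgt (psi x) = src (psi y),
        psi (comp x y h) = comp (psi x) (psi y) h';
    functor_rres : forall x e (he : is_identity e),
      exists he' : is_identity (psi e),
        psi (rres e he x) = rres (psi e) he' (psi x);
    functor_lres : forall x e (he : is_identity e),
      exists he' : is_identity (psi e),
        psi (lres e he x) = lres (psi e) he' (psi x)
  }.

Section TraceCategory.

Variable S : localisableType.
Implicit Types x y : S.

Fact splusK x : x^{+}^{+} = x^{+}.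
Proof. by rewrite -[x^{+} in LHS]sminus_plus splus_minus sminus_plus. Qed.

Fact sminusK x : x^{-}^{-} = x^{-}.
Proof. by rewrite -[x^{-} in LHS]splus_minus sminus_plus splus_minus. Qed.

Fact splus_trace x y : x^{-} = y^{+} -> (x * y)^{+} = x^{+}.
Proof. by move=> h; rewrite splusMr -h smul_minus. Qed.

Fact sminus_trace x y : x^{-} = y^{+} -> (x * y)^{-} = y^{-}.
Proof. by move=> h; rewrite sminusMl h splus_mul. Qed.

Definition trace_product x y of x^{-} = y^{+} : S := x * y.

Definition left_transcription (e : S) of (exists y : S, e = y^{+}) : S -> S :=
  fun x => e * x.

Definition right_transcription (f : S) of (exists y : S, f = y^{+}) : S -> S :=
  fun x => x * f.

Fact trace_src x (h : x^{+}^{-} = x^{+}) : trace_product h = x.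
Proof. exact: splus_mul. Qed.

Fact trace_tgt x (h : x^{-} = x^{-}^{+}) : trace_product h = x.
Proof. exact: smul_minus. Qed.

Definition trace_category : preTranscriptionCat :=
  @PreTranscriptionCat S (@splus S) (@sminus S) trace_product
    left_transcription right_transcription
    splusK (@sminus_plus S) (@splus_minus S) sminusK
    splus_trace sminus_trace trace_src trace_tgt
    (fun x y z _ _ _ _ => @smulA S x y z).

End TraceCategory.

(* Main.v *)
Require Import Defs.
From mathcomp Require Import ssreflect ssrfun ssrbool monoid.

Local Open Scope group_scope.

(** The source and target conditions are the same on both sides, and a
    semigroup morphism clearly preserves trace products and transcriptions, as
    these are all products. Conversely, every product is a trace product of
    transcriptions: [x * y] is the composite of [x|_(y^+)] and [_(x^-)|y].
    These compose because both [(x y^+)^-] and [(x^- y)^+] equal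
    [e := x^- y^+] ([trace_restrict]). Although [x^-] and [y^+] need not
    commute, the composite [x y^+ x^- y = x e e y] collapses to [x e y = x y]
    because [e] is an identity of the category, hence idempotent
    ([mul_restrict]). A functor preserves each ingredient of this
    factorisation, so it preserves products. *)

(** Since [y^+] is also the [-]-image of itself, the law for [x^- y^-] applies to
    it; dually for [splus_restrict]. *)
Lemma sminus_restrict (S : localisableType) (x y : S) :
  (x * y^{+})^{-} = x^{-} * y^{+}.
Proof. by rewrite -(sminus_plus y) -sminusMr. Qed.

Lemma splus_restrict (S : localisableType) (x y : S) :
  (x^{-} * y)^{+} = x^{-} * y^{+}.
Proof. by rewrite -(splus_minus x) -splusMl. Qed.

(** The definedness condition for the composite of [x|_(y^+)] and [_(x^-)|y]. *)
Lemma trace_restrict (S : localisableType) (x y : S) :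
  (x * y^{+})^{-} = (x^{-} * y)^{+}.
Proof. by rewrite sminus_restrict splus_restrict. Qed.

(** The two factors are [x * e] and [e * y] for the identity [e := x^- y^+], so
    only its idempotence is at stake, not commutation of [x^-] with [y^+]. *)
Lemma mul_restrict (S : localisableType) (x y : S) :
  (x * y^{+}) * (x^{-} * y) = x * y.
Proof.
pose e := x^{-} * y^{+}.
have ee : e * e = e.
  have eP : e^{+} = e by rewrite /e -sminus_restrict splus_minus.
  by rewrite -{1}eP splus_mul.
have xey : x * (e * y) = x * y.
  by rewrite /e -smulA splus_mul smulA smul_minus.
have -> : x * y^{+} = x * e by rewrite /e smulA smul_minus.
have -> : x^{-} * y = e * y by rewrite /e -smulA splus_mul.
by rewrite -smulA (smulA e) ee.
Qed.

Theorem theorem4p8 (S S' : localisableType) (phi : S -> S') :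
  localisable_morphism phi <->
  @transcription_functor (trace_category S) (trace_category S') phi.
Proof.
split=> [[phiM phiP phiN] | [phiP phiN phiC phiR phiL]].
  have phi_id e : (exists y : S, e = y^{+}) -> exists y : S', phi e = y^{+}.
    by case=> y ->; exists (phi y); rewrite phiP.
  split=> //= x y.
  - move=> h; have h' : (phi x)^{-} = (phi y)^{+} by rewrite phiN h -phiP.
    by exists h'; apply: phiM.
  - by move=> he; exists (phi_id _ he); apply: phiM.
  - by move=> he; exists (phi_id _ he); apply: phiM.
split=> // x y.
have xN_id : exists z : S, x^{-} = z^{+} by exists x^{-}; rewrite splus_minus.
have yP_id : exists z : S, y^{+} = z^{+} by exists y.
have phi_rres : phi (x * y^{+}) = phi x * (phi y)^{+}.
  by rewrite [RHS](congr1 _ (phiP y)); case: (phiR x _ yP_id).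
have phi_lres : phi (x^{-} * y) = (phi x)^{-} * phi y.
  by rewrite [RHS](congr1 (fun z => z * _) (phiN x)); case: (phiL y _ xN_id).
have phi_comp : phi (x * y^{+} * (x^{-} * y)) =
    phi (x * y^{+}) * phi (x^{-} * y).
  by case: (phiC _ _ (trace_restrict S x y)).
by rewrite -mul_restrict phi_comp phi_rres phi_lres mul_restrict.
Qed.
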